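(* Let $\mathcal{H}$ be a Hilbert space, let $B,K:\mathcal{H}\to\mathcal{H}$ be bounded invertible self-adjoint operators, where $K$ has finitely many negative eigenvalues, of total multiplicity $\kappa<\infty$, and let $T=BK$, regarded as a bounded self-adjoint operator in the Pontryagin space $\Pi_\kappa$ generated by $\mathcal{H}$ and $[\cdot,\cdot]=(K\cdot,\cdot)$. Let $\Pi_c$ be a subspace of $\Pi_\kappa$ related to the absolutely continuous spectrum of $T$. Then $[f,f]>0$ for every nonzero $f\in\Pi_c$.
   Context: A Pontryagin space $\Pi_\kappa$ is a Hilbert space with a sesquilinear form $[\cdot,\cdot]$ and a decomposition $\Pi_\kappa=\Pi_+\oplus\Pi_-$, orthogonal with respect to $[\cdot,\cdot]$, such that $\Pi_+$ is a Hilbert space with inner product $[\cdot,\cdot]$, $\Pi_-$ is a Hilbert space with inner product $-[\cdot,\cdot]$, and $\dim\Pi_-=\kappa<\infty$. Given $\mathcal{H}$ with inner product $(\cdot,\cdot)$ and a bounded self-adjoint $K$ with trivial kernel (its inverse may be unbounded) whose negative spectral subspace has finite dimension $\kappa$, one sets $[u,v]=(Ku,v)$ and extends $\mathcal{H}$ to $\Pi_\kappa$, i.e. $\Pi_\kappa$ is the completion of $\mathcal{H}$ in the norm $(|K|u,u)^{1/2}$ (equal to $\mathcal{H}$ if $K^{-1}$ is bounded), with $\Pi_-$ the negative spectral subspace of $K$. The operator $T=BK$ satisfies $[Tf,g]=[f,Tg]$ and is regarded as a bounded operator in $\Pi_\kappa$. A subspace related to the absolutely continuous spectrum of $T$ means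 a closed $T$-invariant subspace $\Pi_c\subset\Pi_\kappa$ on which $T$ has purely absolutely continuous spectrum, that is, $T|_{\Pi_c}$ is similar (via a bounded, boundedly invertible map) to a self-adjoint operator on a Hilbert space with purely absolutely continuous spectrum. In particular $\Pi_c$ contains no eigenvectors of $T$ and no nonzero finite-dimensional $T$-invariant subspace. *)

(* Defs.v *)
(* MathComp / MathComp-Analysis. *)
From HB Require Export structures.
From mathcomp Require Export all_boot all_order all_algebra complex.
From mathcomp Require Export all_classical all_reals all_analysis.
Export numFieldNormedType.Exports.
Export Order.TTheory GRing.Theory Num.Theory.

Set Implicit Arguments.
Unset Strict Implicit.
Unset Printing Implicit Defensive.

Global Open Scope classical_set_scope.
Global Open Scope ring_scope.
Global Open Scope complex_scope.

(* Complex Hilbert spaces; the inner product is linear in its first argument. *)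
HB.mixin Record CompleteNormedModule_isHilbert (R : realType) V
    & CompleteNormedModule R[i] V := {
  inner : {dot V for (@Num.conj R[i])} ;
  inner_norm : forall x : V, inner x x = `|x| ^+ 2
}.

#[short(type="hilbertType")]
HB.structure Definition Hilbert (R : realType) :=
  {V of CompleteNormedModule R[i] V & CompleteNormedModule_isHilbert R V}.

Section linear_subspaces.
Context {R : realType} {H : hilbertType R}.

Definition closed_subspace (V : set H) : Prop :=
  [/\ V 0, (forall (a : R[i]) x y, V x -> V y -> V (a *: x + y)) & closed V].

Definition has_dim (V : set H) (n : nat) : Prop :=
  exists e : 'I_n -> H,
    (forall a : 'I_n -> R[i], \sum_i a i *: e i = 0 -> forall i, a i = 0) /\
    (forall x, V x <-> exists a : 'I_n -> R[i], x = \sum_i a i *: e i).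

End linear_subspaces.

Definition bounded_selfadjoint {R : realType} {H : hilbertType R}
    (A : {linear H -> H}) : Prop :=
  continuous A /\ forall x y, inner (A x) y = inner x (A y).

(* |K| as the nonnegative square root of K^2. *)
Definition is_absolute_value {R : realType} {H : hilbertType R}
    (K absK : {linear H -> H}) : Prop :=
  [/\ bounded_selfadjoint absK, (forall x, 0 <= inner (absK x) x)
    & forall x, absK (absK x) = K (K x)].

(* For an orthogonal projection E D, this is (E D u, u).  The form
   (E D u, E D u) is nonnegative also when D is not Borel, where a
   projection-valued measure is unconstrained. *)
Definition spectral_mass {R : realType} {H : hilbertType R}
    (E : set (measurableTypeR R) -> {linear H -> H}) (u : H)
    (D : set (measurableTypeR R)) : \bar R :=
  (complex.Re (inner (E D u) (E D u)))%:E.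

(* Projection-valued measures on the Borel sets of the real line. *)
Record pvm (R : realType) (H : hilbertType R) := Pvm {
  pvm_fun :> set (measurableTypeR R) -> {linear H -> H} ;
  pvm_selfadjoint : forall D, measurable D -> bounded_selfadjoint (pvm_fun D) ;
  pvm_idempotent : forall D, measurable D ->
    forall x, pvm_fun D (pvm_fun D x) = pvm_fun D x ;
  pvm0 : forall x, pvm_fun set0 x = 0 ;
  pvmT : forall x, pvm_fun setT x = x ;
  pvmI : forall D D', measurable D -> measurable D' ->
    forall x, pvm_fun (D `&` D') x = pvm_fun D (pvm_fun D' x) ;
  pvm_sigma_additive : forall u, semi_sigma_additive (spectral_mass pvm_fun u)
}.

Section spectral_measure.
Context {R : realType} {H : hilbertType R}.
Variables (E : pvm H) (u : H).

Let spectral_mass0 : spectral_mass E u set0 = 0%E.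
Proof.
by rewrite /spectral_mass pvm0 inner_norm normr0 expr0n.
Qed.

Let spectral_mass_ge0 D : (0 <= spectral_mass E u D)%E.
Proof.
rewrite /spectral_mass lee_fin inner_norm.
have : 0 <= `|E D u| ^+ 2 by exact: exprn_ge0.
by rewrite lecE => /andP[].
Qed.

HB.instance Definition _ := isMeasure.Build _ _ _ (spectral_mass E u)
  spectral_mass0 spectral_mass_ge0 (@pvm_sigma_additive _ _ E u).

End spectral_measure.

(* A = \int t dE(t).  The spectral measure of a bounded operator has bounded
   support, and by polarization the integral is pinned by its quadratic form. *)
Definition is_spectral_measure {R : realType} {H : hilbertType R}
    (A : {linear H -> H}) (E : pvm H) : Prop :=
  (exists M : R, forall u, E `[- M, M]%classic u = u) /\
  (forall u, inner (A u) u = (\int[spectral_mass E u]_t t)%:C).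

Definition negative_spectral_subspace {R : realType} {H : hilbertType R}
    (E : pvm H) : set H :=
  range (E `]-oo, 0[%classic).

Definition purely_ac_spectrum {R : realType} {H : hilbertType R}
    (A : {linear H -> H}) : Prop :=
  exists E : pvm H, is_spectral_measure A E /\
    forall u, spectral_mass E u `<< lebesgue_measure.

(* The Hilbert inner product of a Pontryagin space is normalised: it is [.,.]
   on pplus and -[.,.] on pminus, and the two summands are orthogonal for it. *)
Record pontryagin (R : realType) (k : nat) := Pontryagin {
  pspace :> hilbertType R ;
  pform : {hermitian_sym pspace for (@Num.conj R[i])} ;
  pplus : set pspace ;
  pminus : set pspace ;
  pplus_closed : closed_subspace pplus ;
  pminus_closed : closed_subspace pminus ;
  pdecomp : forall f, exists g h, [/\ pplus g, pminus h & f = g + h] ;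
  pform_orth : forall g h, pplus g -> pminus h -> pform g h = 0 ;
  inner_orth : forall g h, pplus g -> pminus h -> inner g h = 0 ;
  pform_plus : forall g g', pplus g -> pplus g' -> pform g g' = inner g g' ;
  pform_minus : forall h h', pminus h -> pminus h' ->
    - pform h h' = inner h h' ;
  pminus_dim : has_dim pminus k
}.

(* P, together with the embedding iota, is the Pontryagin space generated by
   H and (K ., .): the completion of H in the norm (|K|u,u)^(1/2). *)
Record pontryagin_completion (R : realType) (H : hilbertType R) (k : nat)
    (K absK : {linear H -> H}) (E : pvm H) (P : pontryagin R k)
    (iota : {linear H -> P}) : Prop := PontryaginCompletion {
  completion_dense : dense (range iota) ;
  completion_norm : forall u, `|iota u| ^+ 2 = inner (absK u) u ;
  completion_form : forall u v, pform P (iota u) (iota v) = inner (K u) v ;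
  completion_minus : @pminus R k P = iota @` negative_spectral_subspace E
}.

(* S is an isomorphism, bounded in both directions, of M onto the subspace V. *)
Definition bounded_iso_onto {R : realType} {M H : hilbertType R}
    (S : {linear M -> H}) (V : set H) : Prop :=
  [/\ continuous S, range S = V
    & exists S' : H -> M, cancel S S' /\ {within V, continuous S'}].

Definition ac_subspace {R : realType} {H : hilbertType R}
    (T : {linear H -> H}) (V : set H) : Prop :=
  [/\ closed_subspace V, (forall f, V f -> V (T f))
    & exists (M : hilbertType R) (A : {linear M -> M}) (S : {linear M -> H}),
      [/\ bounded_selfadjoint A, purely_ac_spectrum A, bounded_iso_onto S V
        & forall x, T (S x) = S (A x)]].

(* Main.v *)
Require Import Defs.
From mathcomp Require Import ring lra measurable_realfun.

Set Implicit Arguments.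
Unset Strict Implicit.
Unset Printing Implicit Defensive.

(** Write the subspace as the range of an isomorphism S that turns the
self-adjoint operator A, with absolutely continuous spectral measure F, into
the restriction of T, and put q(x, y) = Re [S x, S y].  This is a bounded
symmetric form with q(A x, y) = q(x, A y), and it is nonnegative up to finitely
many squares: if h is the component of S x in the negative summand, then
q(x, x) = |S x|^2 - 2 |h|^2 >= c |x|^2 - 2 |h|^2, where c > 0 comes from the
bounded inverse of S, and |h|^2 is a finite sum of squares phi_j(x)^2 of bounded
functionals.

The finitely many squares disappear because the spectrum is continuous.  Cut
the line into small intervals and let x_i be the corresponding spectral pieces
of x.  The pieces are orthogonal for q as well as for the inner product, so
q(x, x) = sum q(x_i, x_i) >= c |x|^2 - 2 sum_(i, j) phi_j(x_i)^2.  The pieces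
being orthogonal, sum_i phi_j(x_i)^2 <= |phi_j|^2 max_i |x_i|^2
(sum_sq_orthogonal_le), and by absolute continuity this is as small as desired
when the mesh is fine.  Hence q(x, x) >= c |x|^2 (form_coercive), a uniform
version of the claim.

The q-orthogonality of the pieces (form_cut) holds because A is symmetric for q.
On the spectral subspaces of two separated intervals, with centres l
and m and half-lengths r and s, the identity
(m - l) q(x, y) = q((A - l) x, y) - q(x, (A - m) y) improves any bound of |q| on
the two subspaces by the factor (r + s) / |m - l| < 1, so q vanishes there
(form_separated); adjacent intervals follow by letting the gap shrink.

Only positivity and real-linearity matter, so all forms are replaced by their
real parts: rinner, rnorm and rform take values in R, where the order is
total. *)

(** * Real parts of inner products *)

Lemma Re_conj (R : realType) (z : R[i]) :
  complex.Re (Num.conj z) = complex.Re z.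
Proof. by case: z. Qed.

Lemma ReD (R : realType) (z w : R[i]) :
  complex.Re (z + w) = complex.Re z + complex.Re w.
Proof. by case: z w => a b []. Qed.

Lemma Re_mulr (R : realType) (r : R) (z : R[i]) :
  complex.Re (r%:C * z) = r * complex.Re z.
Proof. by case: z => a b /=; rewrite mul0r subr0. Qed.

Section real_inner_product.
Context {R : realType} {H : hilbertType R}.
Implicit Types (x y z : H) (r : R).

Definition rinner x y : R := complex.Re (inner x y).
Definition rnorm x : R := complex.Re `|x|.

Lemma rinnerC x y : rinner x y = rinner y x.
Proof. by rewrite /rinner hermC expr0 mul1r Re_conj. Qed.

Lemma rinnerDl x y z : rinner (x + y) z = rinner x z + rinner y z.
Proof. by rewrite /rinner linearDl ReD. Qed.

Lemma rinnerDr x y z : rinner z (x + y) = rinner z x + rinner z y.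
Proof. by rewrite rinnerC rinnerDl !(rinnerC z). Qed.

Lemma rinnerZl r x y : rinner (r%:C *: x) y = r * rinner x y.
Proof. by rewrite /rinner linearZl_LR Re_mulr. Qed.

Lemma rinnerZr r x y : rinner x (r%:C *: y) = r * rinner x y.
Proof. by rewrite rinnerC rinnerZl rinnerC. Qed.

Lemma rinner0l x : rinner 0 x = 0.
Proof. by rewrite /rinner linear0l. Qed.

Lemma rinner0r x : rinner x 0 = 0.
Proof. by rewrite rinnerC rinner0l. Qed.

Lemma rinnerNl x y : rinner (- x) y = - rinner x y.
Proof. by apply/eqP; rewrite -addr_eq0 -rinnerDl addNr rinner0l. Qed.

Lemma rinnerNr x y : rinner x (- y) = - rinner x y.
Proof. by rewrite rinnerC rinnerNl rinnerC. Qed.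

Lemma rinner_suml I (s : seq I) (f : I -> H) x :
  rinner (\sum_(i <- s) f i) x = \sum_(i <- s) rinner (f i) x.
Proof.
by apply: (big_morph (rinner^~ x)) => [y z|]; rewrite ?rinnerDl ?rinner0l.
Qed.

Lemma rnormE x : (rnorm x)%:C = `|x|.
Proof. by rewrite RRe_real. Qed.

Lemma rnorm_ge0 x : 0 <= rnorm x.
Proof. by rewrite -lecR rnormE normr_ge0. Qed.

Lemma rnorm0 : rnorm 0 = 0.
Proof. by rewrite /rnorm normr0. Qed.

Lemma rnorm_eq0 x : rnorm x = 0 -> x = 0.
Proof. by move=> h; apply/normr0_eq0; rewrite -rnormE h. Qed.

Lemma rnormZ r x : rnorm (r%:C *: x) = `|r| * rnorm x.
Proof.
apply: complexI; rewrite rnormE normrZ -rnormE rmorphM normc_def /=.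
by rewrite expr0n addr0 sqrtr_sqr.
Qed.

Lemma rnorm_sq x : rnorm x ^+ 2 = rinner x x.
Proof.
by apply: complexI; rewrite /rinner inner_norm -rnormE -rmorphXn.
Qed.

Lemma rinner_ge0 x : 0 <= rinner x x.
Proof. by rewrite -rnorm_sq sqr_ge0. Qed.

Lemma rinner_eq0 x : rinner x x = 0 -> x = 0.
Proof. by rewrite -rnorm_sq => /eqP; rewrite expf_eq0/= => /eqP/rnorm_eq0. Qed.

(** Expand the square of the vector |y| x - |x| y. *)
Lemma rinner_le x y : rinner x y <= rnorm x * rnorm y.
Proof.
have [/eqP x0|x0] := boolP (rnorm x == 0).
  by rewrite (rnorm_eq0 x0) rinner0l rnorm0 mul0r.
have [/eqP y0|y0] := boolP (rnorm y == 0).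
  by rewrite (rnorm_eq0 y0) rinner0r rnorm0 mulr0.
have px : 0 < rnorm x by rewrite lt_def x0 rnorm_ge0.
have py : 0 < rnorm y by rewrite lt_def y0 rnorm_ge0.
have := rinner_ge0 ((rnorm y)%:C *: x - (rnorm x)%:C *: y).
rewrite !(rinnerDl, rinnerDr, rinnerNl, rinnerNr, rinnerZl, rinnerZr).
rewrite -!rnorm_sq (rinnerC y x) => h.
rewrite -(ler_pM2l (mulr_gt0 px py)); nra.
Qed.

Lemma rinner_abs_le x y : `|rinner x y| <= rnorm x * rnorm y.
Proof.
rewrite ler_norml rinner_le andbT lerNl -rinnerNl.
have -> : rnorm x = rnorm (- x) by rewrite /rnorm normrN.
exact: rinner_le.
Qed.

End real_inner_product.

Lemma continuous_linear_rnorm {R : realType} {V W : hilbertType R}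
    (f : {linear V -> W}) :
  continuous f -> exists2 C : R, 0 < C & forall x, rnorm (f x) <= C * rnorm x.
Proof.
move=> /linear_bounded_continuous/linear_boundedP/pinfty_ex_gt0[C C0 fC].
have CE : (complex.Re C)%:C = C by rewrite RRe_real// gtr0_real.
exists (complex.Re C); first by rewrite -ltcR CE.
by move=> x; rewrite -lecR rmorphM/= CE !rnormE.
Qed.

(** * Projection-valued measures *)

Section pvm_lemmas.
Context {R : realType} {H : hilbertType R}.
Variable E : pvm H.
Implicit Types (x y : H) (D : set (measurableTypeR R)).

Lemma pvm_rinner D x y : measurable D -> rinner (E D x) y = rinner x (E D y).
Proof. by move=> mD; rewrite /rinner (pvm_selfadjoint E mD).2. Qed.

Lemma spectral_massE x D : spectral_mass E x D = (rinner (E D x) (E D x))%:E.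
Proof. by []. Qed.

Lemma pvm_disjoint D D' x : measurable D -> measurable D' -> D `&` D' = set0 ->
  E D (E D' x) = 0.
Proof. by move=> mD mD' d; rewrite -pvmI// d pvm0. Qed.

Lemma pvm_sub D D' x : measurable D -> measurable D' -> D `<=` D' ->
  E D' (E D x) = E D x.
Proof. by move=> mD mD' /setIidr d; rewrite -pvmI// d. Qed.

Lemma pvm_orth D D' x y : measurable D -> measurable D' -> D `&` D' = set0 ->
  rinner (E D x) (E D' y) = 0.
Proof. by move=> mD mD' d; rewrite pvm_rinner// pvm_disjoint// rinner0r. Qed.

(** Additivity of a projection-valued measure is only given for the scalars
|E(D) x|^2; expanding the square of the defect recovers it for vectors. *)
Lemma pvmU D D' x : measurable D -> measurable D' -> D `&` D' = set0 ->
  E (D `|` D') x = E D x + E D' x.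
Proof.
move=> mD mD' d; set U := D `|` D'.
have mU : measurable U by exact: measurableU.
apply/subr0_eq/rinner_eq0; rewrite -rnorm_sq.
have dU : spectral_mass E x U = (spectral_mass E x D + spectral_mass E x D')%E.
  by rewrite measureU.
move: dU; rewrite !spectral_massE -EFinD => -[dU].
have eD y : rinner (E U x) (E D y) = rinner (E D x) (E D y).
  by rewrite !pvm_rinner// [E U _]pvm_sub// ?pvm_idempotent// => t; left.
have eD' y : rinner (E U x) (E D' y) = rinner (E D' x) (E D' y).
  by rewrite !pvm_rinner// [E U _]pvm_sub// ?pvm_idempotent// => t; right.
rewrite rnorm_sq !(rinnerDl, rinnerDr, rinnerNl, rinnerNr).
rewrite (rinnerC _ (E U x)) (rinnerC (E D' x) (E U x)) !(eD, eD') dU.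
rewrite (pvm_orth _ _ mD mD' d) (pvm_orth _ _ mD' mD) 1?setIC//; lra.
Qed.

Lemma pvmC D x : measurable D -> E D x + E (~` D) x = x.
Proof.
by move=> mD; rewrite -pvmU ?setICr// ?setUv ?pvmT//; exact: measurableC.
Qed.

End pvm_lemmas.

(** * Spectral localization of a bounded self-adjoint operator *)

Section spectral_resolution.
Context {R : realType} {H : hilbertType R}.
Variables (A : {linear H -> H}) (E : pvm H).
Hypothesis Asym : forall x y : H, inner (A x) y = inner x (A y).
Hypothesis AE : is_spectral_measure A E.
Implicit Types (x y : H) (D : set (measurableTypeR R)).

Lemma pvm_comm D D' x : measurable D -> measurable D' ->
  E D (E D' x) = E D' (E D x).
Proof. by move=> mD mD'; rewrite -!pvmI// setIC. Qed.

Lemma pvmC_eq D x : measurable D -> E D x = x -> E (~` D) x = 0.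
Proof.
move=> mD Dx; have := pvmC E x mD; rewrite Dx => /eqP.
by rewrite addrC -subr_eq0 addrK => /eqP.
Qed.

Lemma selfadjoint_rinner x y : rinner (A x) y = rinner x (A y).
Proof. by rewrite /rinner Asym. Qed.

Lemma spectral_mass_lty x D : (spectral_mass E x D < +oo)%E.
Proof. by rewrite spectral_massE ltry. Qed.

Lemma spectral_integrable x :
  (spectral_mass E x).-integrable setT (fun t : measurableTypeR R => t%:E).
Proof.
have [[M EM] _] := AE.
have mI : measurable (`[- M, M]%classic : set (measurableTypeR R)).
  exact: measurable_itv.
have mN := measurableC mI.
apply/(negligible_integrable mN) => //; first exact/measurable_EFinP.
  by rewrite /= spectral_massE (pvmC_eq mI (EM x)) rinner0l.
rewrite setTD setCK.
have : (spectral_mass E x).-integrable `[- M, M]%classic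
    (EFin \o (id : measurableTypeR R -> R)).
  apply: measurable_bounded_integrable => //.
    exact: spectral_mass_lty.
  exists `|M|; split => // r Mr t /=; rewrite in_itv/= => /andP[Mt tM].
  rewrite (le_trans _ (ltW Mr))// ler_norml.
  by apply/andP; split; move: (ler_norm M); lra.
by [].
Qed.

Lemma rinner_spectral x : rinner (A x) x = \int[spectral_mass E x]_t t.
Proof. by rewrite /rinner AE.2. Qed.

(** The integral of t against the spectral measure only gives the quadratic
form of A.  For x in the range of E(D) and y in its orthogonal complement the
spectral measure of x + y is the sum of those of x and y, so the quadratic form
is additive on the pair and its polar part vanishes. *)
Lemma selfadjoint_reduced D x y : measurable D ->
  E D x = x -> E D y = 0 -> rinner (A x) y = 0.
Proof.
move=> mD Dx Dy.
have massD X : measurable X ->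
    spectral_mass E (x + y) X = (spectral_mass E x X + spectral_mass E y X)%E.
  move=> mX; rewrite !spectral_massE -EFinD; congr _%:E.
  have xy : rinner (E X x) (E X y) = 0.
    rewrite pvm_rinner// pvm_idempotent// -{1}Dx pvm_rinner//.
    by rewrite pvm_comm// Dy linear0 rinner0r.
  rewrite linearD/= !(rinnerDl, rinnerDr) (rinnerC (E X y) (E X x)) xy.
  by rewrite addr0 add0r.
have : rinner (A (x + y)) (x + y) = rinner (A x) x + rinner (A y) y.
  rewrite !rinner_spectral /Rintegral.
  rewrite (eq_measure_integral
    (measure_add (spectral_mass E x) (spectral_mass E y))).
    rewrite integral_measure_add//; try exact: spectral_integrable.
    by rewrite fineD//; apply: integrable_fin_num => //;
      exact: spectral_integrable.
  move=> X mX _; apply: etrans (massD _ mX) _.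
  exact: esym (measure_addE _ _ _).
rewrite linearD/= !(rinnerDl, rinnerDr).
rewrite (selfadjoint_rinner y) (rinnerC y); lra.
Qed.

(** A maps the range of every E(X) into itself: the component of A y outside
that range is orthogonal to A y by [selfadjoint_reduced].  Apply this to D and
to its complement. *)
Lemma spectral_comm D x : measurable D -> E D (A x) = A (E D x).
Proof.
move=> mD.
have stab X y : measurable X -> E X y = y -> E X (A y) = A y.
  move=> mX Xy; apply/esym/subr0_eq.
  have dE : A y - E X (A y) = E (~` X) (A y).
    by rewrite -{1}(pvmC E (A y) mX) addrAC subrr add0r.
  apply: rinner_eq0; rewrite {1}dE pvm_rinner ?dE; last exact: measurableC.
  rewrite pvm_idempotent; last exact: measurableC.
  apply: (selfadjoint_reduced mX Xy).
  by rewrite pvm_disjoint ?setICr//; exact: measurableC.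
have mDC : measurable (~` D) by exact: measurableC.
rewrite -{1}(pvmC E x mD) linearD/= linearD/= stab ?pvm_idempotent//.
rewrite -(stab (~` D) (E (~` D) x)) ?pvm_idempotent//.
by rewrite pvm_disjoint ?setICr// addr0.
Qed.

Lemma spectral_form_bounds (a b : R) x : E `[a, b]%classic x = x ->
  a * rnorm x ^+ 2 <= rinner (A x) x <= b * rnorm x ^+ 2.
Proof.
move=> abx; set D := `[a, b]%classic in abx.
have mD : measurable (D : set (measurableTypeR R)) by exact: measurable_itv.
have mDC : measurable (~` D : set (measurableTypeR R)) by exact: measurableC.
have intD : (spectral_mass E x).-integrable D
    (EFin \o (id : measurableTypeR R -> R)).
  by apply: (integrableS _ _ _ (spectral_integrable x)) => //; exact: measurableT.
have cstD (r : R) : (spectral_mass E x).-integrable D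
    (EFin \o (cst r : measurableTypeR R -> R)).
  apply: measurable_bounded_integrable => //; first exact: spectral_mass_lty.
  by exists `|r|; split => // s rs t _; exact: ltW.
have -> : rinner (A x) x = \int[spectral_mass E x]_(t in D) t.
  rewrite rinner_spectral /Rintegral; congr fine.
  have D0 : spectral_mass E x (~` D) = 0%E.
    by rewrite spectral_massE (pvmC_eq mD abx) rinner0l.
  have := negligible_integral mDC measurableT (spectral_integrable x) D0.
  by rewrite setTD setCK.
have massD : fine (spectral_mass E x D) = rnorm x ^+ 2.
  by rewrite spectral_massE abx rnorm_sq.
rewrite -massD -!(Rintegral_cst (spectral_mass E x) mD).
apply/andP; split; apply: le_Rintegral; rewrite ?/D//=; try exact: cstD.
  by move=> t; rewrite in_itv/= => /andP[].
by move=> t; rewrite in_itv/= => /andP[].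
Qed.

(** The norm of a symmetric operator is at most its numerical radius, on an
invariant real subspace V: polarize with the pair x +- C x / r. *)
Lemma rnorm_le_of_form (C : H -> H) (V : set H) (r : R) x :
  (forall y z, C (y + z) = C y + C z) ->
  (forall s y, C (s%:C *: y) = s%:C *: C y) ->
  (forall y z, rinner (C y) z = rinner y (C z)) ->
  0 < r ->
  (forall u v (s : R), V u -> V v -> V (u + s%:C *: v)) ->
  (forall y, V y -> V (C y)) ->
  (forall y, V y -> `|rinner (C y) y| <= r * rinner y y) ->
  V x -> rnorm (C x) <= r * rnorm x.
Proof.
move=> CD CZ Csym r0 VD VC Cform Vx.
have VCx := VC _ Vx.
have := Cform _ (VD _ _ r^-1 Vx VCx); have := Cform _ (VD _ _ (- r^-1) Vx VCx).
rewrite !ler_norml => /andP[h2 _] /andP[_ h1].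
move: h1 h2; rewrite !CD !CZ.
rewrite !(rinnerDl, rinnerDr, rinnerZl, rinnerZr).
rewrite (Csym (C x) x) (rinnerC (C x) x).
rewrite -!rnorm_sq => h1 h2.
rewrite -(@ler_pXn2r _ 2)// ?nnegrE ?mulr_ge0 ?rnorm_ge0 ?(ltW r0)//.
rewrite exprMn.
have rV : r * r^-1 = 1 by rewrite divff// gt_eqF.
set k := r^-1 in rV h1 h2; move: h1 h2.
set p := rnorm x ^+ 2; set q := rnorm (C x) ^+ 2.
set w := rinner (C (C x)) (C x).
set w' := rinner x (C x) => h1 h2.
have e : r * (k * (k * q)) = k * q by rewrite (mulrA r k) rV mul1r.
have kq : k * q <= r * p by lra.
have -> : q = r * (k * q) by rewrite (mulrA r k) rV mul1r.
by rewrite expr2 -mulrA ler_pM2l.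
Qed.

Lemma spectral_localization (a b : R) x : a < b -> E `[a, b]%classic x = x ->
  rnorm (A x - ((a + b) / 2)%:C *: x) <= (b - a) / 2 * rnorm x.
Proof.
move=> ab abx; set l := (a + b) / 2; set r := (b - a) / 2.
have mD : measurable (`[a, b]%classic : set (measurableTypeR R)).
  exact: measurable_itv.
pose C z := A z - l%:C *: z.
have CD y z : C (y + z) = C y + C z.
  by rewrite /C linearD/= scalerDr opprD addrACA.
have CZ s y : C (s%:C *: y) = s%:C *: C y.
  by rewrite /C linearZ/= scalerBr !scalerA mulrC.
have Csym y z : rinner (C y) z = rinner y (C z).
  by rewrite !(rinnerDl, rinnerDr, rinnerNl, rinnerNr, rinnerZl, rinnerZr)
    selfadjoint_rinner.
have Cform y : E `[a, b]%classic y = y ->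
    `|rinner (C y) y| <= r * rinner y y.
  move=> /spectral_form_bounds; rewrite !rnorm_sq => /andP[h1 h2].
  rewrite /C rinnerDl rinnerNl rinnerZl ler_norml.
  by apply/andP; split; rewrite /l /r; lra.
apply: (@rnorm_le_of_form C (fun y => E `[a, b]%classic y = y)) => //.
- by rewrite /r; lra.
- by move=> u v s abu abv; rewrite linearD/= linearZ/= abu abv.
- by move=> u abu; rewrite /C linearB/= linearZ/= spectral_comm// abu.
Qed.

End spectral_resolution.

Section absolutely_continuous.
Context {R : realType} {H : hilbertType R}.
Variables (E : pvm H).

Let spectral_mass_finite x : fin_num_fun (spectral_mass E x).
Proof. by move=> D mD; rewrite spectral_massE. Qed.

HB.instance Definition _ x := @Measure_isFinite.Build _ _ _
  (spectral_mass E x) (spectral_mass_finite x).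

(** The epsilon-delta form of absolute continuity, which a finite measure
inherits from the variation of the charge that it defines. *)
Lemma ac_spectral_small x : spectral_mass E x `<< lebesgue_measure ->
  forall e : R, 0 < e -> exists2 d : R, 0 < d &
  forall a b, a < b -> b - a < d -> rnorm (E `]a, b]%classic x) < e.
Proof.
move=> ac e e0; pose nu := charge_of_finite_measure (spectral_mass E x).
have [P [N PN]] := Hahn_decomposition nu.
have [d [d0 dP]] := @charge_variation_continuous _ _ _ nu _ _ PN
  lebesgue_measure ac (e ^+ 2) (exprn_gt0 2 e0).
exists d => // a b ab bad.
have mD : measurable (`]a, b]%classic : set (measurableTypeR R)).
  exact: measurable_itv.
have /(dP _ mD) small : (lebesgue_measure `]a, b]%classic < d%:E)%E.
  by rewrite lebesgue_measure_itv/= lte_fin ab lte_fin.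
have : (`|spectral_mass E x `]a, b]%classic| < (e ^+ 2)%:E)%E.
  exact: le_lt_trans (abse_charge_variation PN mD) small.
rewrite spectral_massE /= -rnorm_sq lte_fin normrX ger0_norm ?rnorm_ge0//.
by rewrite ltr_pXn2r// nnegrE ?rnorm_ge0// ltW.
Qed.

End absolutely_continuous.

(** * Forms that commute with the operator *)

Section commuting_form.
Context {R : realType} {H : hilbertType R}.
Variables (A : {linear H -> H}) (E : pvm H).
Hypothesis Asym : forall x y : H, inner (A x) y = inner x (A y).
Hypothesis AE : is_spectral_measure A E.
Hypothesis Eac : forall u, spectral_mass E u `<< lebesgue_measure.

Variable q : H -> H -> R.
Hypothesis qC : forall x y, q x y = q y x.
Hypothesis qDl : forall x y z, q (x + y) z = q x z + q y z.
Hypothesis qZl : forall (r : R) x y, q (r%:C *: x) y = r * q x y.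
Hypothesis qA : forall x y, q (A x) y = q x (A y).
Hypothesis q_bounded :
  exists2 C : R, 0 <= C & forall x y, `|q x y| <= C * (rnorm x * rnorm y).

Let qDr x y z : q x (y + z) = q x y + q x z.
Proof. by rewrite qC qDl !(qC x). Qed.

Let qZr (r : R) x y : q x (r%:C *: y) = r * q x y.
Proof. by rewrite qC qZl qC. Qed.

(** Any bound |q(x, y)| <= K |x| |y| on the two spectral subspaces improves
itself to the same bound with rho K in place of K, where rho < 1 because the
intervals are disjoint; iterating gives zero. *)
Lemma form_separated (a b c d : R) x y : a < b -> b < c -> c < d ->
  E `[a, b]%classic x = x -> E `[c, d]%classic y = y -> q x y = 0.
Proof.
move=> ab bc cd.
have mX : measurable (`[a, b]%classic : set (measurableTypeR R)).
  exact: measurable_itv.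
have mY : measurable (`[c, d]%classic : set (measurableTypeR R)).
  exact: measurable_itv.
have [C C0 qle] := q_bounded.
set l := (a + b) / 2; set m := (c + d) / 2.
set r := (b - a) / 2; set s := (d - c) / 2.
have r0 : 0 < r by rewrite /r; lra.
have s0 : 0 < s by rewrite /s; lra.
have rsm : r + s < m - l by rewrite /r /s /m /l; lra.
have ml0 : 0 < m - l by lra.
pose rho := (r + s) / (m - l).
have rho0 : 0 <= rho by rewrite divr_ge0//; lra.
have rho1 : rho < 1 by rewrite ltr_pdivrMr// mul1r.
have qn n : forall x y, E `[a, b]%classic x = x -> E `[c, d]%classic y = y ->
    `|q x y| <= C * (rnorm x * rnorm y) * rho ^+ n.
  elim: n => [|n IHn] {}x {}y Ex Ey; first by rewrite expr0 mulr1 qle.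
  pose x' := A x - l%:C *: x; pose y' := A y - m%:C *: y.
  have Ex' : E `[a, b]%classic x' = x'.
    by rewrite /x' linearB/= linearZ/= (spectral_comm Asym AE)// Ex.
  have Ey' : E `[c, d]%classic y' = y'.
    by rewrite /y' linearB/= linearZ/= (spectral_comm Asym AE)// Ey.
  have x'r : rnorm x' <= r * rnorm x by exact: (spectral_localization Asym AE).
  have y's : rnorm y' <= s * rnorm y by exact: (spectral_localization Asym AE).
  have qE : (m - l) * q x y = q x' y - q x y'.
    have N1 z : - z = (- 1 : R)%:C *: z :> H.
      by rewrite rmorphN rmorph1 scaleN1r.
    have qNl z : q (- z) y = - q z y by rewrite N1 qZl mulN1r.
    have qNr z : q x (- z) = - q x z by rewrite N1 qZr mulN1r.
    by rewrite /x' /y' qDl qDr qNl qNr qZl qZr qA; ring.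
  have h1 := IHn _ _ Ex' Ey; have h2 := IHn _ _ Ex Ey'.
  have : (m - l) * `|q x y| <= `|q x' y| + `|q x y'|.
    by rewrite -{1}(gtr0_norm ml0) -normrM qE ler_normB.
  move=> /le_trans/(_ (lerD h1 h2)) h3.
  rewrite -(ler_pM2l ml0) (le_trans h3)//.
  have -> : (m - l) * (C * (rnorm x * rnorm y) * rho ^+ n.+1) =
      C * (r * rnorm x * rnorm y + rnorm x * (s * rnorm y)) * rho ^+ n.
    rewrite exprS /rho; field; lra.
  rewrite -mulrDl ler_wpM2r ?exprn_ge0// -mulrDr.
  by rewrite ler_wpM2l// lerD// ?ler_wpM2r ?ler_wpM2l// rnorm_ge0.
move=> Ex Ey; apply/eqP; rewrite -normr_le0.
have rho_norm : `|rho| < 1 by rewrite ger0_norm.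
have /cvgr_to_ge := cvg_geometric (C * (rnorm x * rnorm y)) rho_norm.
apply.
by apply: nearW => n; exact: qn.
Qed.

(** Between `]-oo, a] and `]b, +oo[ the form vanishes by [form_separated]; the
remaining piece over `]a, b] has small norm when b is close to a. *)
Lemma form_cut (a : R) x y :
  q (E `]-oo, a]%classic x) (E `]a, +oo[%classic y) = 0.
Proof.
have [C C0 qle] := q_bounded.
have [[M EM] _] := AE.
have mI (i : interval R) : measurable ([set` i] : set (measurableTypeR R)).
  exact: measurable_itv.
(* `[- K, K] contains the spectrum and leaves room for b beyond a. *)
pose K := `|M| + `|a| + 2.
have MK : M <= K /\ - K <= - M.
  by rewrite /K; split; move: (ler_norm M) (normr_ge0 a); lra.
have aK : - K + 1 <= a /\ a + 1 <= K.
  by rewrite /K; split;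
    move: (ler_norm a) (ler_norm (- a)) (normr_ge0 M); rewrite ?normrN; lra.
set x' := E _ x.
have Ex' : E `[- K, a]%classic x' = x'.
  have -> : x' = E (`]-oo, a]%classic `&` `[- M, M]%classic) x.
    by rewrite pvmI ?EM.
  apply: pvm_sub; [exact: measurableI|exact: mI|].
  by move=> t /=; rewrite !in_itv/= => -[-> /andP[Mt _]]; rewrite andbT; lra.
have qsmall e : 0 < e -> `|q x' (E `]a, +oo[%classic y)| <= C * (rnorm x' * e).
  move=> e0; have [d d0 small] := ac_spectral_small (Eac y) e0.
  pose b := a + Num.min (d / 2) (1 / 2).
  have [ab bK bad] : [/\ a < b, b < K & b - a < d].
    by rewrite /b minEle; case: ifPn => ?; split; lra.
  have -> : `]a, +oo[%classic = `]a, b]%classic `|` `]b, +oo[%classic :> set R.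
    apply/seteqP; split => t /=; rewrite !in_itv/= !andbT.
      by move=> at_; case: (leP t b) => tb; [left; rewrite at_|right].
    by case=> [/andP[]//|]; lra.
  rewrite pvmU//; last first.
    by apply/seteqP; split => t //=; rewrite !in_itv/= !andbT => -[/andP[_]]; lra.
  rewrite qDr (_ : q x' (E `]b, +oo[%classic y) = 0) ?addr0; last first.
    apply: (@form_separated (- K) a b K) => //; first by lra.
    have -> : E `]b, +oo[%classic y =
        E (`]b, +oo[%classic `&` `[- M, M]%classic) y by rewrite pvmI ?EM.
    apply: pvm_sub; [exact: measurableI|exact: mI|].
    by move=> t /=; rewrite !in_itv/= andbT => -[bt /andP[_ tM]]; apply/andP; lra.
  apply: le_trans (qle _ _) _.
  by rewrite ler_wpM2l// ler_wpM2l ?rnorm_ge0// ltW// small.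
apply/eqP; rewrite -normr_le0; apply/ler_addgt0Pl => e e0; rewrite addr0.
set k := C * rnorm x'.
have k0 : 0 <= `|k| by [].
have ke : 0 < e / (`|k| + 1) by rewrite divr_gt0//; lra.
apply: le_trans (qsmall _ ke) _.
rewrite mulrA -/k mulrA ler_pdivrMr; last by lra.
by rewrite mulrC ler_pM2l//; move: (ler_norm k); lra.
Qed.

(** Pythagoras for q along a partition, by induction on the number of cuts.
Applied to the inner product itself it is the usual theorem. *)
Lemma form_partition (a : nat -> R) n x : (forall i, a i <= a i.+1) ->
  q (E `]-oo, a n]%classic x) (E `]-oo, a n]%classic x) =
  q (E `]-oo, a 0%N]%classic x) (E `]-oo, a 0%N]%classic x) +
  \sum_(i < n) q (E `]a i, a i.+1]%classic x) (E `]a i, a i.+1]%classic x).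
Proof.
move=> a_incr; elim: n => [|n IHn]; first by rewrite big_ord0 addr0.
have mI (i : interval R) : measurable ([set` i] : set (measurableTypeR R)).
  exact: measurable_itv.
rewrite big_ord_recr/= addrA -IHn.
have -> : `]-oo, a n.+1]%classic = `]-oo, a n]%classic `|` `]a n, a n.+1]%classic
    :> set R.
  apply/seteqP; split => t /=; rewrite !in_itv/=.
    by move=> tn; case: (leP t (a n)) => ta; [left|right; rewrite tn].
  by case=> [/le_trans -> //|/andP[]//].
rewrite pvmU//; last first.
  by apply/seteqP; split => t //=; rewrite !in_itv/= => -[ta /andP[]]; lra.
set u := E _ x; set v := E `]a n, a n.+1]%classic x.
have uv : q u v = 0.
  rewrite -[v](_ : E `]a n, +oo[%classic v = _) ?form_cut//.
  apply: pvm_sub => // t; rewrite /= !in_itv/= andbT => /andP[]//.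
by rewrite qDl !qDr (qC v u) uv addr0 add0r.
Qed.

End commuting_form.

(** The values of a bounded functional on pairwise orthogonal short vectors have
a small sum of squares s: at z = sum phi(x_i) x_i the functional takes the value
s, whereas |z|^2 <= e^2 s. *)
Lemma sum_sq_orthogonal_le {R : realType} {H : hilbertType R} (phi : H -> R)
    (C e : R) n (x : 'I_n -> H) :
  (forall y z, phi (y + z) = phi y + phi z) ->
  (forall (r : R) y, phi (r%:C *: y) = r * phi y) ->
  (forall y, `|phi y| <= C * rnorm y) ->
  (forall i j, i != j -> rinner (x i) (x j) = 0) ->
  0 <= e -> (forall i, rnorm (x i) <= e) ->
  \sum_i phi (x i) ^+ 2 <= C ^+ 2 * e ^+ 2.
Proof.
move=> phiD phiZ phi_le x_orth e0 x_le.
set s := \sum_i _.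
pose z := \sum_i (phi (x i))%:C *: x i.
have phi0 : phi 0 = 0 by have := phiZ 0 0; rewrite scaler0 mul0r.
have phiz : phi z = s.
  rewrite /z (big_morph phi phiD phi0); apply: eq_bigr => i _.
  by rewrite phiZ expr2.
have z_le : rnorm z ^+ 2 <= e ^+ 2 * s.
  rewrite rnorm_sq /z rinner_suml mulr_sumr; apply: ler_sum => i _.
  rewrite rinnerC rinner_suml (bigD1 i)//= big1 ?addr0; last first.
    by move=> j ji; rewrite rinnerZl rinnerZr x_orth// !mulr0.
  rewrite rinnerZl rinnerZr mulrA -expr2 mulrC ler_wpM2r ?sqr_ge0//.
  by rewrite -rnorm_sq ler_pXn2r// nnegrE rnorm_ge0.
have s0 : 0 <= s by apply: sumr_ge0 => i _; exact: sqr_ge0.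
have ss : s ^+ 2 <= C ^+ 2 * (e ^+ 2 * s).
  apply: (@le_trans _ _ (C ^+ 2 * rnorm z ^+ 2)); last by rewrite ler_wpM2l ?sqr_ge0.
  have sz : s <= C * rnorm z by rewrite -phiz (le_trans (ler_norm _)).
  by rewrite -exprMn ler_pXn2r// nnegrE// (le_trans s0 sz).
have [->|sn0] := eqVneq s 0; first by rewrite mulr_ge0 ?sqr_ge0.
by rewrite -(@ler_pM2r _ s) ?lt_def ?sn0// -mulrA -expr2.
Qed.

Section coercive.
Context {R : realType} {H : hilbertType R}.
Variables (A : {linear H -> H}) (E : pvm H).
Hypothesis Asym : forall x y : H, inner (A x) y = inner x (A y).
Hypothesis AE : is_spectral_measure A E.
Hypothesis Eac : forall u, spectral_mass E u `<< lebesgue_measure.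

Variable q : H -> H -> R.
Hypothesis qC : forall x y, q x y = q y x.
Hypothesis qDl : forall x y z, q (x + y) z = q x z + q y z.
Hypothesis qZl : forall (r : R) x y, q (r%:C *: x) y = r * q x y.
Hypothesis qA : forall x y, q (A x) y = q x (A y).
Hypothesis q_bounded :
  exists2 C : R, 0 <= C & forall x y, `|q x y| <= C * (rnorm x * rnorm y).

Lemma fine_partition x (e : R) : 0 < e -> exists (n : nat) (a : nat -> R),
  [/\ forall i, a i <= a i.+1, forall i, rnorm (E `]a i, a i.+1]%classic x) <= e,
      E `]-oo, a 0%N]%classic x = 0 & E `]-oo, a n]%classic x = x].
Proof.
move=> e0; have [d d0 small] := ac_spectral_small (Eac x) e0.
have [[M EM] _] := AE.
have mI (i : interval R) : measurable ([set` i] : set (measurableTypeR R)).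
  exact: measurable_itv.
pose K := `|M| + 1; pose h := d / 2.
have MK : M < K by rewrite /K; move: (ler_norm M); lra.
have h0 : 0 < h by rewrite /h; lra.
(* Cuts at distance h < d, from below the spectrum to above it. *)
pose a (i : nat) := - K + i%:R * h.
have aS i : a i.+1 = a i + h by rewrite /a -natr1; lra.
have K0 : 0 <= K by rewrite /K; move: (normr_ge0 M); lra.
exists (Num.bound ((K + K) / h)), a; split.
- by move=> i; rewrite aS; lra.
- by move=> i; apply/ltW/small; rewrite aS; rewrite /h in h0 *; lra.
- rewrite -(EM x) pvm_disjoint//.
  by apply/seteqP; split => t //=; rewrite !in_itv/= /a => -[ta /andP[]]; lra.
- rewrite -[in LHS](EM x) pvm_sub// => t /=; rewrite !in_itv/= => /andP[_ tM].
  have := @archi_boundP _ ((K + K) / h); rewrite ltr_pdivrMr// => /(_ _) b.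
  have : K + K < (Num.bound ((K + K) / h))%:R * h.
    by apply: b; rewrite divr_ge0//; lra.
  by rewrite /a; lra.
Qed.

(** Finitely many negative squares cannot survive absolutely continuous
spectrum: replace x by its spectral pieces over a fine partition, which leaves both
|x|^2 and q(x, x) unchanged and makes the squares negligible. *)
Lemma form_coercive (m : nat) (phi : 'I_m -> H -> R) (C : 'I_m -> R) (b c : R) :
  0 <= b ->
  (forall j y z, phi j (y + z) = phi j y + phi j z) ->
  (forall j (r : R) y, phi j (r%:C *: y) = r * phi j y) ->
  (forall j y, `|phi j y| <= C j * rnorm y) ->
  (forall x, c * rnorm x ^+ 2 - b * \sum_j phi j x ^+ 2 <= q x x) ->
  forall x, c * rnorm x ^+ 2 <= q x x.
Proof.
move=> b0 phiD phiZ phi_le q_ge x.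
apply/ler_addgt0Pl => e e0.
(* With pieces of norm at most e', the squares contribute at most
   (D - 1) * e' ^+ 2 <= e; the summand 1 keeps D positive. *)
pose D := b * (\sum_j C j ^+ 2) + 1.
have D0 : 0 < D.
  by rewrite ltr_wpDl// mulr_ge0// sumr_ge0// => j _; exact: sqr_ge0.
pose e' := Num.sqrt (e / D).
have e'0 : 0 < e' by rewrite sqrtr_gt0 divr_gt0.
have e'2 : e' ^+ 2 = e / D by rewrite sqr_sqrtr// divr_ge0// ltW.
have [n [a [a_incr small a0 an]]] := fine_partition x e'0.
pose xi (i : 'I_n) := E `]a i, a i.+1]%classic x.
have qx : q x x = \sum_i q (xi i) (xi i).
  have := form_partition Asym AE Eac qC qDl qZl qA q_bounded n x a_incr.
  rewrite an a0 => ->.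
  have -> : q 0 0 = 0 by have := qZl 0 0 0; rewrite scaler0 mul0r.
  by rewrite add0r.
have nx : rnorm x ^+ 2 = \sum_i rnorm (xi i) ^+ 2.
  have rb : exists2 C : R, 0 <= C &
      forall y z : H, `|rinner y z| <= C * (rnorm y * rnorm z).
    by exists 1 => // y z; rewrite mul1r rinner_abs_le.
  have := form_partition Asym AE Eac (@rinnerC _ H) (@rinnerDl _ H)
    (@rinnerZl _ H) (selfadjoint_rinner Asym) rb n x a_incr.
  rewrite an a0 rinner0l add0r rnorm_sq => ->.
  by apply: eq_bigr => i _; rewrite rnorm_sq.
have a_mono i j : (i <= j)%N -> a i <= a j.
  elim: j => [|j IHj]; first by rewrite leqn0 => /eqP->.
  by rewrite leq_eqVlt => /predU1P[->//|/IHj/le_trans]; apply.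
have xi_lt (i j : 'I_n) : (i < j)%N -> rinner (xi i) (xi j) = 0.
  move=> ij; apply: pvm_orth; try exact: measurable_itv.
  apply/seteqP; split => t //=; rewrite !in_itv/= => -[/andP[_ t1] /andP[t2 _]].
  by have := a_mono _ _ ij; lra.
have xi_orth (i j : 'I_n) : i != j -> rinner (xi i) (xi j) = 0.
  by rewrite neq_ltn => /orP[/xi_lt//|ji]; rewrite rinnerC xi_lt.
rewrite addrC -lerBlDr.
have : c * rnorm x ^+ 2 - b * \sum_j \sum_i phi j (xi i) ^+ 2 <= q x x.
  rewrite qx nx mulr_sumr exchange_big/= mulr_sumr -sumrB.
  by apply: ler_sum => i _; exact: q_ge.
apply: le_trans; rewrite lerD2l lerN2.
apply: (@le_trans _ _ (b * (\sum_j C j ^+ 2 * e' ^+ 2))).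
  apply: ler_wpM2l => //; apply: ler_sum => j _.
  apply: (sum_sq_orthogonal_le (phiD j) (phiZ j) (phi_le j) xi_orth (ltW e'0)).
  by move=> i; exact: small.
rewrite -mulr_suml e'2 mulrA mulrA.
by rewrite ler_pdivrMr// (mulrC e) ler_wpM2r ?(ltW e0)// /D lerDl.
Qed.

End coercive.

(** * Finite-dimensional subspaces *)

Section orthonormal_expansion.
Context {R : realType} {H : hilbertType R}.

(** For an orthonormal family us, this says that h lies in its real span.  The
formulation as an expansion avoids carrying orthonormality along. *)
Definition expands_in (us : seq H) (h : H) :=
  h = \sum_(u <- us) (rinner h u)%:C *: u.

Lemma expands_in0 us : expands_in us 0.
Proof. by rewrite /expands_in big1// => u _; rewrite rinner0l scale0r. Qed.

Lemma expands_inD us g h :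
  expands_in us g -> expands_in us h -> expands_in us (g + h).
Proof.
rewrite /expands_in => {1}-> {1}->; rewrite -big_split; apply: eq_bigr => u _ /=.
by rewrite rinnerDl rmorphD scalerDl.
Qed.

Lemma expands_inZ us (r : R) h : expands_in us h -> expands_in us (r%:C *: h).
Proof.
rewrite /expands_in => {1}->; rewrite scaler_sumr; apply: eq_bigr => u _ /=.
by rewrite rinnerZl rmorphM scalerA.
Qed.

Lemma expands_in_comb us (s : seq H) (r : H -> R) :
  (forall u, u \in s -> expands_in us u) ->
  expands_in us (\sum_(u <- s) (r u)%:C *: u).
Proof.
elim: s => [|v s IHs] sus.
  by rewrite big_nil; exact: expands_in0.
rewrite big_cons; apply: expands_inD; first by apply/expands_inZ/sus/mem_head.
by apply: IHs => u us'; apply: sus; rewrite inE us' orbT.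
Qed.

Lemma expands_in_rnorm us h : expands_in us h ->
  rnorm h ^+ 2 = \sum_(u <- us) rinner h u ^+ 2.
Proof.
move=> hE; rewrite rnorm_sq {1}hE rinner_suml; apply: eq_bigr => u _.
by rewrite rinnerZl (rinnerC u) expr2.
Qed.

(** Gram-Schmidt.  That each member of us expands in us replaces orthonormality:
it is what makes e minus its expansion orthogonal to us. *)
Lemma exists_orthonormal_expansion (es : seq H) (V : set H) :
  (forall (r : R) x y, V x -> V y -> V (r%:C *: x + y)) -> V 0 ->
  (forall e, e \in es -> V e) ->
  exists us : seq H, [/\ forall u, u \in us -> V u,
    forall u, u \in us -> expands_in us u & forall e, e \in es -> expands_in us e].
Proof.
move=> VD V0; elim: es => [|e es IHes] Ves.
  by exists [::].
have [|us [Vus uus esus]] := IHes.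
  by move=> e' e'es; apply: Ves; rewrite inE e'es orbT.
pose p := \sum_(u <- us) (rinner e u)%:C *: u.
pose d := e - p.
have dorth u : u \in us -> rinner u d = 0.
  move=> /uus uE; rewrite /d rinnerDr rinnerNr.
  rewrite {1}uE rinner_suml /p (rinnerC u) rinner_suml -sumrB big1_seq// => v /=.
  by rewrite !rinnerZl (rinnerC v e) (rinnerC v u) mulrC subrr.
have [d0|d_neq0] := eqVneq d 0.
  exists us; split => // e'; rewrite inE => /predU1P[->|]; last exact: esus.
  by apply/subr0_eq.
have d_gt0 : rnorm d != 0.
  by apply: contra d_neq0 => /eqP/rnorm_eq0 ->.
pose w := ((rnorm d)^-1)%:C *: d.
have worth h : expands_in us h -> rinner h w = 0.
  move=> ->; rewrite rinner_suml big1_seq// => u /= uus'.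
  by rewrite rinnerZl /w rinnerZr dorth// !mulr0.
have ext h : expands_in us h -> expands_in (w :: us) h.
  by move=> hE; rewrite /expands_in big_cons worth// scale0r add0r.
have wd : expands_in (w :: us) d.
  rewrite /expands_in big_cons big1_seq ?addr0 => [|u /= uu]; last first.
    by rewrite rinnerC dorth// scale0r.
  rewrite /w rinnerZr -rnorm_sq scalerA -rmorphM/= expr2 mulrA mulVf// mul1r.
  by rewrite divff// scale1r.
have Vd : V d.
  have Vp : V p.
    rewrite /p; elim: (us) Vus => [|u us' IH] Vus'; first by rewrite big_nil.
    rewrite big_cons; apply: VD; first by apply: Vus'; rewrite mem_head.
    by apply: IH => v vus; apply: Vus'; rewrite inE vus orbT.
  rewrite /d addrC -[- p]scaleN1r -(rmorphN1 (real_complex R)).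
  by apply: VD => //; apply: Ves; rewrite mem_head.
exists (w :: us); split => [u|u|e'].
- rewrite inE => /predU1P[->|/Vus//].
  by rewrite -[w]addr0; exact: VD.
- by rewrite inE => /predU1P[->|/uus/ext//]; exact: expands_inZ.
- rewrite inE => /predU1P[->|/esus/ext//].
  have -> : e = d + p by rewrite subrK.
  apply: expands_inD => //; apply: ext.
  exact: expands_in_comb.
Qed.

End orthonormal_expansion.

(** * Pontryagin spaces *)

Section pontryagin_form.
Context {R : realType} {k : nat} (P : pontryagin R k).
Implicit Types f g : P.

Definition rform f g : R := complex.Re (pform P f g).

Lemma rformC f g : rform f g = rform g f.
Proof. by rewrite /rform hermC expr0 mul1r Re_conj. Qed.

Lemma rformDl f g h : rform (f + g) h = rform f h + rform g h.
Proof. by rewrite /rform linearDl ReD. Qed.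

Lemma rformDr f g h : rform h (f + g) = rform h f + rform h g.
Proof. by rewrite rformC rformDl !(rformC h). Qed.

Lemma rformZl (r : R) f g : rform (r%:C *: f) g = r * rform f g.
Proof. by rewrite /rform linearZl_LR Re_mulr. Qed.

Lemma pform_selfE f : pform P f f = (rform f f)%:C.
Proof.
have := hermC (pform P) f f; rewrite expr0 mul1r /rform.
by case: (pform P f f) => a b [] b0; congr Complex; lra.
Qed.

Lemma rinner_orth g h : pplus g -> pminus h -> rinner g h = 0.
Proof. by move=> Pg Ph; rewrite /rinner inner_orth. Qed.

Lemma rform_decomp g h g' h' : pplus g -> pminus h -> pplus g' -> pminus h' ->
  rform (g + h) (g' + h') = rinner g g' - rinner h h'.
Proof.
move=> Pg Ph Pg' Ph'; rewrite rformDl !rformDr (rformC h g').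
rewrite /rform (pform_orth Pg Ph') (pform_orth Pg' Ph) (pform_plus Pg Pg').
rewrite /rinner -(pform_minus Ph Ph').
by case: (pform P h h') => a b /=; lra.
Qed.

(** The defect of [f, f] from |f|^2 depends only on the negative component h,
which is seen through the inner products of f with negative vectors. *)
Lemma rform_self f : exists h, [/\ pminus h,
  forall u, pminus u -> rinner h u = rinner f u &
  rform f f = rnorm f ^+ 2 - 2 * rnorm h ^+ 2].
Proof.
have [g [h [Pg Ph ->]]] := pdecomp f.
exists h; split => //.
  by move=> u Pu; rewrite rinnerDl (rinner_orth Pg Pu) add0r.
rewrite rform_decomp// !rnorm_sq !(rinnerDl, rinnerDr) (rinnerC h g).
by rewrite (rinner_orth Pg Ph); lra.
Qed.

(** The form is the inner product composed with the reflection g + h |-> g - h,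
which is an isometry. *)
Lemma rform_le f f' : `|rform f f'| <= rnorm f * rnorm f'.
Proof.
have [g [h [Pg Ph ->]]] := pdecomp f; have [g' [h' [Pg' Ph' ->]]] := pdecomp f'.
have -> : rform (g + h) (g' + h') = rinner (g - h) (g' + h').
  rewrite rform_decomp// !(rinnerDl, rinnerDr, rinnerNl) (rinnerC h g').
  by rewrite (rinner_orth Pg Ph') (rinner_orth Pg' Ph); lra.
have -> : rnorm (g + h) = rnorm (g - h).
  apply/eqP; rewrite -(@eqrXn2 _ 2) ?rnorm_ge0// !rnorm_sq.
  rewrite !(rinnerDl, rinnerDr, rinnerNl, rinnerNr) (rinnerC h g).
  by rewrite (rinner_orth Pg Ph); apply/eqP; lra.
exact: rinner_abs_le.
Qed.

Lemma pminus_expansion : exists us : seq P, (forall u, u \in us -> pminus u) /\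
  forall h, pminus h -> expands_in us h.
Proof.
have [e [_ eP]] := pminus_dim P.
have [P0 PD _] := pminus_closed P.
have PZD (r : R) (x y : P) : pminus x -> pminus y -> pminus (r%:C *: x + y).
  exact: PD.
(* A complex basis e spans over the reals together with 'i *: e. *)
pose es := [seq e i | i : 'I_k] ++ [seq 'i *: e i | i : 'I_k].
have Pe i : pminus (e i).
  apply/eP; exists (fun j => (j == i)%:R).
  by rewrite (bigD1 i)//= eqxx scale1r big1 ?addr0// => j /negbTE->; rewrite scale0r.
have Pes f : f \in es -> pminus f.
  rewrite mem_cat => /orP[] /mapP[i _ ->]; first exact: Pe.
  by rewrite -['i *: e i]addr0; apply: PD.
have [us [Pus _ usP]] := exists_orthonormal_expansion PZD P0 Pes.
exists us; split => // h /eP[a ->].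
apply: big_ind => [|x y|i _].
- exact: expands_in0.
- exact: expands_inD.
- rewrite [a i]complexE scalerDl mulrC -scalerA.
  by apply: expands_inD; apply: expands_inZ; apply: usP; rewrite mem_cat;
    apply/orP; [left|right]; apply/mapP; exists i; rewrite ?mem_enum.
Qed.

End pontryagin_form.

Lemma dense_functional_eq0 {R : realType} {H V : hilbertType R}
    (iota : {linear H -> V}) (L : V -> R) (C : R) :
  dense (range iota) -> (forall f g, L (f + g) = L f + L g) ->
  (forall f, `|L f| <= C * rnorm f) -> (forall u, L (iota u) = 0) ->
  forall f, L f = 0.
Proof.
move=> di LD LC Li f; apply/eqP; rewrite -normr_le0; apply/ler_addgt0Pl => e e0.
rewrite addr0; pose d := e / (`|C| + 1).
have d0 : 0 < d by rewrite divr_gt0//; move: (normr_ge0 C); lra.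
have [||g [fg [u _ ug]]] := di (ball f d%:C)^°.
- by exists f; apply/nbhs_ballP; exists d%:C => //=; rewrite ltcR.
- exact: open_interior.
have : ball f d%:C g by exact: interior_subset fg.
rewrite -ball_normE/= -rnormE ltcR => fgd.
have -> : L f = L (f - iota u).
  by rewrite -[RHS]addr0 -(Li u) -LD subrK.
rewrite ug (le_trans (LC _))//.
apply: (@le_trans _ _ ((`|C| + 1) * d)); last by rewrite mulrC divfK// gt_eqF.
apply: (@le_trans _ _ ((`|C| + 1) * rnorm (f - g))).
  by rewrite ler_wpM2r ?rnorm_ge0//; move: (ler_norm C); lra.
by rewrite ler_wpM2l ?addr_ge0//; exact: ltW.
Qed.

(** The inverse of S is only known to be a function continuous on V; continuity
at 0 together with homogeneity of S gives the bound. *)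
Lemma rnorm_bounded_below {R : realType} {M H : hilbertType R}
    (S : {linear M -> H}) (V : set H) : bounded_iso_onto S V ->
  exists2 d : R, 0 < d & forall x, d * rnorm x <= rnorm (S x).
Proof.
move=> [_ SV [S' [SK S'c]]].
have V0 : V 0 by rewrite -SV; exists 0 => //; rewrite linear0.
have S'0 : S' 0 = 0 by rewrite -[in LHS](linear0 S) SK.
have : S' @ within V (nbhs (0 : H)) --> (0 : M).
  by rewrite -S'0; move/subspace_continuousP : S'c; apply.
move=> /cvgrPdist_lt/(_ 1 ltr01)/nbhs_ballP[d /= d0 dP].
have dE : (complex.Re d)%:C = d by rewrite RRe_real// gtr0_real.
exists (complex.Re d); first by rewrite -ltcR dE.
move=> x; rewrite leNgt; apply/negP => xd.
have x0 : 0 < rnorm x.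
  rewrite lt_def rnorm_ge0 andbT; apply: contraTneq xd => /rnorm_eq0 ->.
  by rewrite linear0 !rnorm0 mulr0 ltxx.
pose y := ((rnorm x)^-1)%:C *: x.
have ny : rnorm y = 1.
  by rewrite rnormZ ger0_norm ?invr_ge0 ?rnorm_ge0// mulVf// gt_eqF.
have := dP (S y); rewrite -ball_normE /= sub0r normrN => /(_ _ _).
have Sy : `|S y| < d.
  rewrite -dE -rnormE ltcR linearZ/= rnormZ ger0_norm ?invr_ge0 ?rnorm_ge0//.
  by rewrite ltr_pdivrMl// mulrC.
have VSy : V (S y) by rewrite -SV; exists y.
by move=> /(_ Sy VSy); rewrite SK sub0r normrN -[`|y|]rnormE ny ltxx.
Qed.

(** On the image of iota the symmetry of T = B K is that of K B K; the defect of
symmetry is bounded in each variable, so density extends it to the completion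
one variable at a time. *)
Lemma completion_symmetric (R : realType) (H : hilbertType R) (k : nat)
    (B K absK : {linear H -> H}) (E : pvm H) (P : pontryagin R k)
    (iota : {linear H -> P}) (T : {linear P -> P}) :
  bounded_selfadjoint B -> bounded_selfadjoint K ->
  pontryagin_completion K absK E iota -> continuous T ->
  (forall u, T (iota u) = iota (B (K u))) ->
  forall f g, rform (T f) g = rform f (T g).
Proof.
move=> [_ Bsym] [_ Ksym] [iota_dense _ iota_form _] Tc TBK.
have [C C0 TC] := continuous_linear_rnorm Tc.
pose D f g := rform (T f) g - rform f (T g).
have D_le f g : `|D f g| <= 2 * C * (rnorm f * rnorm g).
  rewrite /D (le_trans (ler_normB _ _))//.
  have := rform_le (T f) g; have := rform_le f (T g).
  have : rnorm (T f) * rnorm g <= C * rnorm f * rnorm g.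
    by rewrite ler_wpM2r ?rnorm_ge0.
  have : rnorm f * rnorm (T g) <= rnorm f * (C * rnorm g).
    by rewrite ler_wpM2l ?rnorm_ge0.
  lra.
have DDl f f' g : D (f + f') g = D f g + D f' g.
  by rewrite /D linearD/= !rformDl; lra.
have DDr f g g' : D f (g + g') = D f g + D f g'.
  by rewrite /D linearD/= !rformDr; lra.
have Diota u v : D (iota u) (iota v) = 0.
  by rewrite /D !TBK /rform !iota_form Ksym Bsym Ksym subrr.
have Diota' u g : D (iota u) g = 0.
  apply: (dense_functional_eq0 (C := 2 * C * rnorm (iota u)) iota_dense) => //.
  by move=> f; rewrite -mulrA.
move=> f g; apply/subr0_eq; rewrite -/(D f g).
apply: (dense_functional_eq0 (L := D^~ g) (C := 2 * C * rnorm g) iota_dense) => //.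
by move=> h; rewrite -mulrA (mulrC (rnorm g)).
Qed.

Theorem theorem2 (R : realType) (H : hilbertType R) (k : nat)
    (B K : {linear H -> H})
    (hB : bounded_selfadjoint B) (injB : injective B)
    (hK : bounded_selfadjoint K) (injK : injective K)
    (E : pvm H) (hE : is_spectral_measure K E)
    (hk : has_dim (negative_spectral_subspace E) k)
    (absK : {linear H -> H}) (habsK : is_absolute_value K absK)
    (P : pontryagin R k) (iota : {linear H -> P})
    (hP : pontryagin_completion K absK E iota)
    (T : {linear P -> P}) (hT : continuous T)
    (hTBK : forall u, T (iota u) = iota (B (K u)))
    (Pc : set P) (hPc : ac_subspace T Pc) :
  forall f : P, Pc f -> f != 0 -> 0 < pform P f f.
Proof.
have Tsym := completion_symmetric hB hK hP hT hTBK.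
have [_ _ [M [A [S [[_ Asym] [F [AF Fac]] isoS TS]]]]] := hPc.
have [d d0 S_ge] := rnorm_bounded_below isoS.
have [Sc SPc _] := isoS.
have [C C0 S_le] := continuous_linear_rnorm Sc.
have [us [Pus usP]] := pminus_expansion P.
pose q x y := rform (S x) (S y).
have q_ge x : d ^+ 2 * rnorm x ^+ 2 -
    2 * \sum_(j < size us) rinner (S x) us`_j ^+ 2 <= q x x.
  rewrite /q; have [h [Ph hu ->]] := rform_self (S x).
  have -> : rnorm h ^+ 2 = \sum_(j < size us) rinner (S x) us`_j ^+ 2.
    rewrite (expands_in_rnorm (usP _ Ph)) (big_nth 0) big_mkord.
    by apply: eq_bigr => j _; rewrite hu//; apply/Pus/mem_nth.
  rewrite lerD2r -exprMn ler_pXn2r ?nnegrE ?rnorm_ge0//.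
  by rewrite mulr_ge0 ?rnorm_ge0// ltW.
have coercive : forall x, d ^+ 2 * rnorm x ^+ 2 <= q x x.
  apply: (form_coercive Asym AF Fac _ _ _ _ _
    (phi := fun (j : 'I_(size us)) x => rinner (S x) us`_j)
    (C := fun j => C * rnorm us`_j) _ _ _ _ q_ge) => //.
  - by move=> x y; exact: rformC.
  - by move=> x y z; rewrite /q linearD rformDl.
  - by move=> r x y; rewrite /q linearZ rformZl.
  - by move=> x y; rewrite /q -!TS Tsym.
  - exists (C ^+ 2); first exact: sqr_ge0.
    move=> x y; apply: le_trans (rform_le _ _) _.
    by rewrite expr2 mulrACA ler_pM ?rnorm_ge0.
  - by move=> j y z; rewrite linearD rinnerDl.
  - by move=> j r y; rewrite linearZ rinnerZl.
  - move=> j y; apply: le_trans (rinner_abs_le _ _) _.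
    by rewrite mulrAC ler_wpM2r ?rnorm_ge0.
move=> f; rewrite -SPc => -[x _ <-] Sx0.
rewrite pform_selfE ltcR; apply: lt_le_trans (coercive x).
rewrite mulr_gt0 ?exprn_gt0// lt_def rnorm_ge0 andbT.
by apply: contraNneq Sx0 => /rnorm_eq0 ->; rewrite linear0.
Qed.
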